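(* Let $\triangle$ be the $\mathcal{QM}$-invariant Laplacian on $B^{4n}$, defined for $f\in C^2(B^{4n})$ by $(\triangle f)(\mathbf{a})=\triangle_0(f\circ\varphi_{\mathbf{a}})(\mathbf{0})$, $\mathbf{a}\in B^{4n}$. Then, as differential operators acting on $C^2(B^{4n})$, $$\triangle = 4(1-|\mathbf{q}|^2)\left(\tfrac14\triangle_0+\mathfrak{D}-R^{0'}R^{1'}+R^{0'}+R^{1'}\right),$$ where $$\mathfrak{D}=\sum_{A,B=1}^{2n}z_A^{1'}z_B^{0'}\nabla_A^{0'}\nabla_B^{1'},\qquad R^{A'}=\sum_{A=1}^{2n}z_A^{A'}\nabla_A^{A'},\quad A'=0',1'.$$
   Context: $\mathbb{H}$ is the quaternion algebra, $n\ge 1$, $\mathbb{H}^n$ is the space of quaternionic $(n\times1)$ column vectors, $\mathbf{a}^*=\bar{\mathbf{a}}^t$, $|\mathbf{q}|^2=\mathbf{q}^*\mathbf{q}$, $B^{4n}=\{\mathbf{q}\in\mathbb{H}^n:|\mathbf{q}|<1\}$, and $\triangle_0$ is the standard Euclidean Laplacian on $\mathbb{R}^{4n}\cong\mathbb{H}^n$. For $\mathbf{a}\in B^{4n}$ put $s_{\mathbf{a}}=(1-|\mathbf{a}|^2)^{1/2}$, $\mathbf{A}=(1-s_{\mathbf{a}})|\mathbf{a}|^{-2}\mathbf{a}\mathbf{a}^*+s_{\mathbf{a}}I_n$ (with $\mathbf{A}=I_n$ if $\mathbf{a}=\mathbf{0}$), and $\varphi_{\mathbf{a}}(\mathbf{q})=(\mathbf{a}-\mathbf{A}\mathbf{q})(1-\mathbf{a}^*\mathbf{q})^{-1}$,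 an automorphism of $B^{4n}$. Write $\mathbf{q}=(q_1,\dots,q_n)^t$ with $q_l=x_{4l-4}+x_{4l-3}\mathbf{i}+x_{4l-2}\mathbf{j}+x_{4l-1}\mathbf{k}$, $l=1,\dots,n$. Complex-valued functions $z_A^{A'}$ ($A=1,\dots,2n$, $A'=0',1'$) are defined by $z_l^{0'}=x_{4l-4}+\mathbf{i}x_{4l-3}$, $z_l^{1'}=-x_{4l-2}-\mathbf{i}x_{4l-1}$, $z_{n+l}^{0'}=x_{4l-2}-\mathbf{i}x_{4l-1}$, $z_{n+l}^{1'}=x_{4l-4}-\mathbf{i}x_{4l-3}$ (here $\mathbf{i}$ is the complex imaginary unit), and complex vector fields $\nabla_A^{A'}$ by $\nabla_l^{0'}=\frac12(\partial_{x_{4l-4}}-\mathbf{i}\partial_{x_{4l-3}})$, $\nabla_l^{1'}=\frac12(-\partial_{x_{4l-2}}+\mathbf{i}\partial_{x_{4l-1}})$, $\nabla_{n+l}^{0'}=\frac12(\partial_{x_{4l-2}}+\mathbf{i}\partial_{x_{4l-1}})$, $\nabla_{n+l}^{1'}=\frac12(\partial_{x_{4l-4}}+\mathbf{i}\partial_{x_{4l-3}})$; they satisfy $\nabla_A^{A'}z_B^{B'}=\delta_{AB}\delta^{A'B'}$. *)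

(* Defs.v *)
From HB Require Import structures.
From mathcomp Require Import all_boot all_order all_algebra.
From mathcomp Require Import complex ring lra.
From mathcomp Require Import all_classical all_reals all_analysis.

Set Implicit Arguments.
Unset Strict Implicit.
Unset Printing Implicit Defensive.

Import Order.TTheory GRing.Theory Num.Theory.
Import numFieldNormedType.Exports.

Local Open Scope classical_set_scope.
Local Open Scope ring_scope.

Record quat (R : Type) : Type := Quat { q0 : R; q1 : R; q2 : R; q3 : R }.

Section QuaternionRing.
Variable R : realFieldType.
Implicit Types x y z : quat R.

Definition tuple_of_quat x := (q0 x, q1 x, q2 x, q3 x).
Definition quat_of_tuple (t : R * R * R * R) :=
  Quat t.1.1.1 t.1.1.2 t.1.2 t.2.
Lemma tuple_of_quatK : cancel tuple_of_quat quat_of_tuple.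
Proof. by case. Qed.
HB.instance Definition _ := Choice.copy (quat R) (can_type tuple_of_quatK).

Definition addq x y :=
  Quat (q0 x + q0 y) (q1 x + q1 y) (q2 x + q2 y) (q3 x + q3 y).
Definition oppq x := Quat (- q0 x) (- q1 x) (- q2 x) (- q3 x).
Definition mulq x y :=
  Quat (q0 x * q0 y - q1 x * q1 y - q2 x * q2 y - q3 x * q3 y)
       (q0 x * q1 y + q1 x * q0 y + q2 x * q3 y - q3 x * q2 y)
       (q0 x * q2 y - q1 x * q3 y + q2 x * q0 y + q3 x * q1 y)
       (q0 x * q3 y + q1 x * q2 y - q2 x * q1 y + q3 x * q0 y).
Definition realq (r : R) := Quat r 0 0 0.
Definition conjq x := Quat (q0 x) (- q1 x) (- q2 x) (- q3 x).
Definition sqnormq x := q0 x ^+ 2 + q1 x ^+ 2 + q2 x ^+ 2 + q3 x ^+ 2.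
Definition invq x := mulq (conjq x) (realq (sqnormq x)^-1).

Lemma addqA : associative addq.
Proof. by move=> x y z; rewrite /addq /= !addrA. Qed.
Lemma addqC : commutative addq.
Proof. by move=> x y; congr Quat; rewrite addrC. Qed.
Lemma add0q : left_id (realq 0) addq.
Proof. by case=> a b c d; rewrite /addq /= !add0r. Qed.
Lemma addNq : left_inverse (realq 0) oppq addq.
Proof. by case=> a b c d; rewrite /addq /= !addNr. Qed.
HB.instance Definition _ :=
  GRing.isZmodule.Build (quat R) addqA addqC add0q addNq.

Lemma mulqA : associative mulq.
Proof. by move=> x y z; congr Quat => /=; ring. Qed.
Lemma mul1q : left_id (realq 1) mulq.
Proof. by case=> a b c d; congr Quat => /=; ring. Qed.
Lemma mulq1 : right_id (realq 1) mulq.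
Proof. by case=> a b c d; congr Quat => /=; ring. Qed.
Lemma mulqDl : left_distributive mulq addq.
Proof. by move=> x y z; congr Quat => /=; ring. Qed.
Lemma mulqDr : right_distributive mulq addq.
Proof. by move=> x y z; congr Quat => /=; ring. Qed.
Lemma oneq_neq0 : realq 1 != realq 0.
Proof. by apply/eqP => -[] /eqP; rewrite oner_eq0. Qed.
HB.instance Definition _ :=
  GRing.Zmodule_isNzRing.Build (quat R) mulqA mul1q mulq1 mulqDl mulqDr
    oneq_neq0.

Lemma sqnormq_eq0 x : (sqnormq x == 0) = (x == 0).
Proof.
case: x => a b c d; rewrite /sqnormq /=.
rewrite !paddr_eq0 ?addr_ge0 ?sqr_ge0 // !sqrf_eq0.
apply/idP/eqP => [/andP[/andP[/andP[/eqP-> /eqP->] /eqP->] /eqP->] //|].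
by case=> -> -> -> ->; rewrite eqxx.
Qed.
Lemma mulVq : {in [pred x | x != 0 :> quat R], left_inverse 1 invq *%R}.
Proof.
move=> x; rewrite inE -sqnormq_eq0 /sqnormq => nz.
by congr Quat; rewrite /= /sqnormq; field.
Qed.
Lemma mulqV : {in [pred x | x != 0 :> quat R], right_inverse 1 invq *%R}.
Proof.
move=> x; rewrite inE -sqnormq_eq0 /sqnormq => nz.
by congr Quat; rewrite /= /sqnormq; field.
Qed.
Lemma quat_unitP x y : y * x = 1 /\ x * y = 1 -> [pred x | x != 0 :> quat R] x.
Proof.
move=> [yx _]; apply/eqP => x0; move: yx; rewrite x0 mulr0 => /esym/eqP.
by rewrite oner_eq0.
Qed.
Lemma invq_out : {in [predC [pred x | x != 0 :> quat R]], invq =1 id}.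
Proof.
move=> x; rewrite !inE negbK => /eqP ->.
by congr Quat; rewrite /= ?oppr0 !mul0r ?mulr0 ?subr0 ?addr0.
Qed.
HB.instance Definition _ :=
  GRing.NzRing_hasMulInverse.Build (quat R) mulVq mulqV quat_unitP invq_out.

End QuaternionRing.

Section QuaternionicSpace.
Variables (R : realType) (n : nat).

(* coordinate c (among 0, 1, 2, 3) of the l-th quaternion, l counted from 0 *)
Lemma cidx_subproof (l : 'I_n) (c : 'I_4) : (4 * l + c < 4 * n)%N.
Proof.
rewrite (@leq_trans (4 * l.+1)%N) // ?leq_mul2l ?ltn_ord //.
by rewrite mulnS addnC ltn_add2r.
Qed.
Definition cidx (l : 'I_n) (c : 'I_4) : 'I_(4 * n) :=
  Ordinal (cidx_subproof l c).

Lemma qidx_subproof (k : 'I_(4 * n)) : (k %/ 4 < n)%N.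
Proof. by rewrite ltn_divLR // [(n * 4)%N]mulnC. Qed.
Definition qidx (k : 'I_(4 * n)) : 'I_n := Ordinal (qidx_subproof k).

Definition toH (x : 'rV[R]_(4 * n)) : 'cV[quat R]_n :=
  \col_l Quat (x 0 (cidx l 0)) (x 0 (cidx l 1))
              (x 0 (cidx l 2)) (x 0 (cidx l 3)).

Definition ofH (q : 'cV[quat R]_n) : 'rV[R]_(4 * n) :=
  \row_k let x := q (qidx k) 0 in [:: q0 x; q1 x; q2 x; q3 x]`_(k %% 4).

Lemma toHK : cancel toH ofH.
Proof.
move=> x; apply/rowP => k; rewrite !mxE /=.
have xk (c : 'I_4) : c = (k %% 4)%N :> nat -> x 0 (cidx (qidx k) c) = x 0 k.
  move=> ck; congr (x 0 _); apply: val_inj => /=.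
  by rewrite ck [RHS](divn_eq k 4) mulnC.
have: (k %% 4 < 4)%N by rewrite ltn_mod.
by case e: (k %% 4)%N xk => [|[|[|[|//]]]] xk _ /=; apply: xk.
Qed.

Lemma ofHK : cancel ofH toH.
Proof.
move=> q; apply/colP => l; rewrite !mxE.
have hq (c : 'I_4) : qidx (cidx l c) = l.
  by apply: val_inj; rewrite /= mulnC divnMDl // divn_small ?addn0.
have hm (c : 'I_4) : ((cidx l c) %% 4 = c)%N.
  by rewrite /= mulnC modnMDl modn_small.
by rewrite !hq !hm /=; case: (q l 0).
Qed.

Definition adjq m p (M : 'M[quat R]_(m, p)) : 'M[quat R]_(p, m) :=
  map_mx (@conjq R) M^T.

(* q^* q is a real quaternion, see [adjq_mul_self] *)
Definition sqnormH (q : 'cV[quat R]_n) : R := q0 ((adjq q *m q) 0 0).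

Lemma adjq_mul_self (q : 'cV[quat R]_n) :
  (adjq q *m q) 0 0 = realq (sqnormH q).
Proof.
rewrite /sqnormH mxE.
elim/big_rec: _ => [//|i y _ ->]; rewrite !mxE.
by case: (q i 0) => a b c d; congr Quat => /=; ring.
Qed.

Definition s_ (a : 'cV[quat R]_n) : R := Num.sqrt (1 - sqnormH a).

Definition Amx (a : 'cV[quat R]_n) : 'M[quat R]_n :=
  if a == 0 then 1%:M
  else realq ((1 - s_ a) * (sqnormH a)^-1) *: (a *m adjq a)
       + realq (s_ a) *: 1%:M.

(* the right multiplication of a column by a quaternion is the matrix product
   by a 1 x 1 matrix *)
Definition phi (a q : 'cV[quat R]_n) : 'cV[quat R]_n :=
  (a - Amx a *m q) *m ((1 - (adjq a *m q) 0 0)^-1)%:M.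

Definition unitball : set 'rV[R]_(4 * n) := [set x | sqnormH (toH x) < 1].

Definition phiR (a : 'rV[R]_(4 * n)) (x : 'rV[R]_(4 * n)) :=
  ofH (phi (toH a) (toH x)).

End QuaternionicSpace.

Section Differentiability.
Variables (R : realType) (N : nat).

Definition ebase (k : 'I_N) : 'rV[R]_N := delta_mx 0 k.

(* C^k on an open set U: only the values on U matter *)
Fixpoint Ck (k : nat) (U : set 'rV[R]_N) (u : 'rV[R]_N -> R) : Prop :=
  (forall x, U x -> {for x, continuous u}) /\
  if k is k'.+1 then
    forall i, (forall x, U x -> derivable u x (ebase i)) /\
              Ck k' U (fun x => 'D_(ebase i) u x)
  else True.

Definition CkC (k : nat) (U : set 'rV[R]_N) (f : 'rV[R]_N -> R[i]) : Prop :=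
  Ck k U (fun x => complex.Re (f x)) /\ Ck k U (fun x => complex.Im (f x)).

(* partial derivative in a real variable of a complex-valued function *)
Definition pd (k : 'I_N) (f : 'rV[R]_N -> R[i]) : 'rV[R]_N -> R[i] :=
  fun x => ('D_(ebase k) (fun y => complex.Re (f y)) x
            +i* 'D_(ebase k) (fun y => complex.Im (f y)) x)%C.

Definition laplace0 (f : 'rV[R]_N -> R[i]) : 'rV[R]_N -> R[i] :=
  fun x => \sum_k pd k (pd k f) x.

End Differentiability.

Section Operators.
Variables (R : realType) (n : nat).
Local Notation V := 'rV[R]_(4 * n).

Inductive primed := p0 | p1.

Definition imi : R[i] := Complex 0 1.
Definition xC (l : 'I_n) (c : 'I_4) (x : V) : R[i] := (x 0 (cidx l c))%:C%C.

(* A : 'I_(n + n) is [lshift n l] for the index l, and [rshift n l] for n+l *)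
Definition zA (A : 'I_(n + n)) (A' : primed) (x : V) : R[i] :=
  match fintype.split A, A' with
  | inl l, p0 => xC l 0 x + imi * xC l 1 x
  | inl l, p1 => - xC l 2 x - imi * xC l 3 x
  | inr l, p0 => xC l 2 x - imi * xC l 3 x
  | inr l, p1 => xC l 0 x - imi * xC l 1 x
  end.

Definition nablaA (A : 'I_(n + n)) (A' : primed) (f : V -> R[i]) : V -> R[i] :=
  fun x =>
  match fintype.split A, A' with
  | inl l, p0 => 2^-1 * (pd (cidx l 0) f x - imi * pd (cidx l 1) f x)
  | inl l, p1 => 2^-1 * (- pd (cidx l 2) f x + imi * pd (cidx l 3) f x)
  | inr l, p0 => 2^-1 * (pd (cidx l 2) f x + imi * pd (cidx l 3) f x)
  | inr l, p1 => 2^-1 * (pd (cidx l 0) f x + imi * pd (cidx l 1) f x)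
  end.

Definition frakD (f : V -> R[i]) : V -> R[i] :=
  fun x => \sum_A \sum_B
    zA A p1 x * zA B p0 x * nablaA A p0 (nablaA B p1 f) x.

Definition Rop (A' : primed) (f : V -> R[i]) : V -> R[i] :=
  fun x => \sum_A zA A A' x * nablaA A A' f x.

Definition laplaceQM (f : V -> R[i]) : V -> R[i] :=
  fun a => laplace0 (fun x => f (phiR a x)) 0.

End Operators.

(* Main.v *)
(** The curve [t |-> phi_a (t e)] through [a] has velocity [(a a^* - A) e], and its
acceleration is obtained by expanding [(1 - t a^* e)^-1] to second order. Summing
over the real basis vectors [e] gives, with [s^2 = 1 - |a|^2],
[sum v v^T = s^2 (I - a a^* )] and [sum w = 4 s^2 a], because
[sum_c c p c = - 2 p^*] over the units [c = 1, i, j, k]. By the second-order chain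
rule, the invariant Laplacian at [a] is therefore
[s^2 (Delta_0 f - sum_(ij) (a a^* )_ij f_ij + 4 sum_i a_i f_i)].
On the other side [R^0' + R^1'] is the Euler field, and [D - R^0' R^1'] equals
[sum_(A,B) (z_A^1' z_B^0' - z_A^0' z_B^1') nabla_A^0' nabla_B^1'] since
[nabla_A^0' z_B^1' = 0]; by the symmetry of second derivatives this is
[- 1/4 sum_(ij) (a a^* )_ij f_ij]. *)

Require Import Defs.
From HB Require Import structures.
From mathcomp Require Import all_boot all_order all_algebra.
From mathcomp Require Import complex ring lra.
From mathcomp Require Import all_classical all_reals all_analysis.

Set Implicit Arguments.
Unset Strict Implicit.
Unset Printing Implicit Defensive.

Import Order.TTheory GRing.Theory Num.Theory.
Import numFieldNormedType.Exports.

Local Open Scope classical_set_scope.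
Local Open Scope ring_scope.

(** * Functions with continuous partial derivatives *)

Section Line.
Variables (R : realType) (V : normedModType R) (u : V -> R) (e z : V) (s : R).

(** The two difference quotients are the same function of [h], so derivability and the value of the
    derivative both transfer from [u] to its restriction to a line. *)
Let growth_line :
  (fun h : R => h^-1 *: (((fun t : R => u (t *: e + z)) \o shift s) (h *: (1 : R))
                         - u (s *: e + z))) =
  (fun h : R => h^-1 *: ((u \o shift (s *: e + z)) (h *: e) - u (s *: e + z))).
Proof.
by apply/funext => h; rewrite /= [h *: 1]mulr1 scalerDl addrA.
Qed.

Lemma derive_line : 'D_1 (fun t : R => u (t *: e + z)) s = 'D_e u (s *: e + z).
Proof. by rewrite /derive growth_line. Qed.

Lemma derivable_line :
  derivable (fun t : R => u (t *: e + z)) s 1 = derivable u (s *: e + z) e.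
Proof. by rewrite /derivable growth_line. Qed.

End Line.

Lemma is_derive_translate (R : realType) (V : normedModType R) (u : V -> R)
    (a z e : V) (d : R) :
  is_derive (a + z) e u d -> is_derive z e (fun y => u (a + y)) d.
Proof.
have E : (fun h : R => h^-1 *: ((u \o shift (a + z)) (h *: e) - u (a + z))) =
         (fun h : R => h^-1 *: (((fun y => u (a + y)) \o shift z) (h *: e)
                                - u (a + z))).
  by apply/funext => h /=; rewrite addrCA.
by move=> [du <-]; apply: DeriveDef; move: du; rewrite /derivable /derive E.
Qed.

Section PartialDerivatives.
Variables (R : realType) (N : nat).
Implicit Types (u : 'rV[R]_N -> R) (x y z : 'rV[R]_N).

(** Since [b] may have either sign, the mean value theorem is used on [[0, b]] or on [[b, 0]], and
    the intermediate point is located only by [|s| <= |b|]. *)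
Lemma line_mean_value u z k (b : R) :
  (forall s : R, `|s| <= `|b| -> derivable u (s *: ebase R k + z) (ebase R k)) ->
  exists2 s : R, `|s| <= `|b| &
    u (b *: ebase R k + z) - u z = 'D_(ebase R k) u (s *: ebase R k + z) * b.
Proof.
set e := ebase R k => du.
pose g (s : R) : R := u (s *: e + z); pose dg (s : R) : R := 'D_e u (s *: e + z).
have dgP (s : R) : `|s| <= `|b| -> is_derive s (1 : R) g (dg s).
  move=> sb; apply: DeriveDef; last exact: derive_line.
  by rewrite /g derivable_line; apply: du.
have cgw (a c : R) : (forall s : R, s \in `[a, c] -> `|s| <= `|b|) ->
    {within `[a, c], continuous g}.
  move=> h; apply: derivable_within_continuous => s sac.
  by have := dgP s (h s sac).
have [b0|b0] := leP 0 b.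
- have sub s : s \in `[0, b] -> `|s| <= `|b|.
    by rewrite in_itv /= => /andP[s0 sb]; rewrite !ger0_norm.
  have sub' s : s \in `]0, b[ -> `|s| <= `|b|.
    by move=> /subset_itv_oo_cc; apply: sub.
  have [s s0b E] := MVT_segment b0 (fun s h => dgP s (sub' s h)) (cgw _ _ sub).
  exists s; first exact: sub.
  by move: E; rewrite /g /dg scale0r add0r subr0.
- have sub s : s \in `[b, 0] -> `|s| <= `|b|.
    by rewrite in_itv /= => /andP[sb s0]; rewrite !ler0_norm ?lerN2 // ltW.
  have sub' s : s \in `]b, 0[ -> `|s| <= `|b|.
    by move=> /subset_itv_oo_cc; apply: sub.
  have [s s0b E] := MVT_segment (ltW b0) (fun s h => dgP s (sub' s h))
    (cgw _ _ sub).
  exists s; first exact: sub.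
  move: E; rewrite /g /dg scale0r add0r sub0r mulrN => /eqP.
  by rewrite -eqr_oppLR opprB => /eqP.
Qed.

Definition hybrid x y j : 'rV[R]_N := \row_i (if (i < j)%N then y 0 i else x 0 i).

(* The slope of [u] along the [i]-th edge of the staircase path from [x] to [y].
   As in Caratheodory's notion of derivative, its limit at [x] stands in for a
   Frechet derivative. *)
Definition slope u x y (i : 'I_N) : R :=
  if y 0 i == x 0 i then 'D_(ebase R i) u x
  else (u (hybrid x y i.+1) - u (hybrid x y i)) / (y 0 i - x 0 i).

Lemma hybridS x y (i : 'I_N) :
  hybrid x y i.+1 = (y 0 i - x 0 i) *: ebase R i + hybrid x y i.
Proof.
apply/rowP => j; rewrite !mxE eqxx /= ltnS leq_eqVlt.
case: eqVneq => [/val_inj ->|ne]; first by rewrite ltnn eqxx mulr1 subrK.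
by rewrite [j == i]negbTE ?mulr0 ?add0r //; apply: contra ne => /eqP ->.
Qed.

(** The increments of [u] along the staircase telescope. On a degenerate edge the increment and
    [y_i - x_i] both vanish, whatever value [slope] takes there. *)
Lemma slopeE u x y :
  u y - u x = \sum_i slope u x y i * (y 0 i - x 0 i).
Proof.
have -> : \sum_i slope u x y i * (y 0 i - x 0 i) =
          \sum_(0 <= i < N) (u (hybrid x y i.+1) - u (hybrid x y i)).
  rewrite big_mkord; apply: eq_bigr => i _; rewrite /slope.
  case: eqVneq => [e|ne]; last by rewrite divfK // subr_eq0.
  by rewrite hybridS e subrr scale0r add0r mulr0 subrr.
rewrite telescope_sumr //; congr (u _ - u _); apply/rowP => i; rewrite mxE.
  by rewrite ltn_ord.
by rewrite ltn0.
Qed.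

Lemma rV_normP x (r : R) : 0 <= r -> reflect (forall i, `|x 0 i| <= r) (`|x| <= r).
Proof.
move=> r0; rewrite [`|x|]/Num.Def.normr /= mx_normrE.
apply: (iffP (bigmax_leP _ _ _ _)) => [[_ h] i|h]; first exact: (h (0, i)).
by split=> // -[i j] _ /=; rewrite ord1.
Qed.

Lemma norm_coord x i : `|x 0 i| <= `|x|.
Proof. by apply/rV_normP. Qed.

(** By the mean value theorem the slope is the [i]-th partial derivative at a point of edge [i]. The
    norm is the max norm, so this edge stays within [|y - x|] of [x], and continuity of the partial
    derivative at [x] applies. *)
Lemma slope_cvg u x (i : 'I_N) :
  (\forall y \near x, derivable u y (ebase R i)) ->
  {for x, continuous (fun y => 'D_(ebase R i) u y)} ->
  slope u x y i @[y --> x] --> 'D_(ebase R i) u x.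
Proof.
move=> du cu; apply: (@cvgrPdist_le _ _ _ (nbhs x) (nbhs_filter x) _ _).2 => e e0.
have cu' := (@cvgrPdist_le _ _ _ (nbhs x) (nbhs_filter x) _ _).1 cu e e0.
have /nbhs_ballP [r /= r0 near_r] : \forall y \near x,
  derivable u y (ebase R i) /\ `|'D_(ebase R i) u x - 'D_(ebase R i) u y| <= e.
  exact: (@filterI _ (nbhs x) _ _ _ du cu').
near=> y.
have yr : `|y - x| < r.
  have : ball x r y by near: y; exact: nbhsx_ballx.
  by rewrite -ball_normE /ball_ /= distrC.
rewrite /slope; case: eqVneq => [_|ne]; first by rewrite subrr normr0 ltW.
have inr (s : R) : `|s| <= `|y 0 i - x 0 i| ->
    ball x r (s *: ebase R i + hybrid x y i).
  move=> sb; rewrite -ball_normE /ball_ /= distrC; apply: le_lt_trans yr.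
  apply/rV_normP => // j; rewrite !mxE eqxx /=.
  have yx k : `|y 0 k - x 0 k| <= `|y - x| by have := norm_coord (y - x) k; rewrite !mxE.
  case: (eqVneq j i) => [->|_]; last first.
    rewrite mulr0 add0r; case: ifP => // _.
    by rewrite subrr normr0.
  by rewrite ltnn mulr1 addrK (le_trans sb).
have [s sb E] := @line_mean_value u (hybrid x y i) i (y 0 i - x 0 i)
  (fun s h => (near_r _ (inr s h)).1).
rewrite hybridS E mulfK ?subr_eq0 //.
exact: (near_r _ (inr s sb)).2.
Unshelve. all: by end_near. Qed.

(** By [slopeE], the difference quotient of [u] along [c] is exactly the sum of the slopes times the
    difference quotients of the coordinates, and each factor converges. *)
Lemma is_derive_curve u (c : R -> 'rV[R]_N) (t : R) (v : 'I_N -> R) :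
  (forall i, \forall y \near c t, derivable u y (ebase R i)) ->
  (forall i, {for c t, continuous (fun y => 'D_(ebase R i) u y)}) ->
  (forall i, is_derive t 1 (fun s : R => c s 0 i) (v i)) ->
  is_derive t 1 (fun s : R => u (c s)) (\sum_i 'D_(ebase R i) u (c t) * v i).
Proof.
move=> du cu dc.
have ct : {for t, continuous c}.
  apply/differentiable_continuous/derivable1_diffP/derivable_mxP => i j.
  by rewrite ord1; have := dc j.
suff L : (fun h : R => h^-1 *: (((fun s : R => u (c s)) \o shift t) (h *: (1 : R))
    - u (c t))) @ 0^' --> \sum_i 'D_(ebase R i) u (c t) * v i.
  apply: DeriveDef; last exact: cvg_lim L.
  by apply/cvg_ex; eexists; exact: L.
have -> : (fun h : R => h^-1 *: (((fun s : R => u (c s)) \o shift t) (h *: (1 : R))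
    - u (c t))) = (fun h : R => \sum_i slope u (c t) (c (h *: (1 : R) + t)) i *
      (h^-1 *: (((fun s : R => c s 0 i) \o shift t) (h *: (1 : R)) - c t 0 i))).
  apply/funext => h; rewrite /= slopeE scaler_sumr; apply: eq_bigr => i _.
  by rewrite scalerAr.
apply: cvg_big; [exact: add_continuous|move=> i _; apply: cvgM].
  apply: (cvg_comp _ _ _ (slope_cvg (du i) (cu i))).
  have : h *: (1 : R) + t @[h --> 0^'] --> 0 *: (1 : R) + t.
    apply: cvg_within_filter.
    by apply: cvgD; [apply: cvgZr_tmp; exact: cvg_id|exact: cvg_cst].
  rewrite scale0r add0r.
  by move=> h; apply: (cvg_comp _ _ h ct).
have [dci <-] := dc i; exact: dci.
Qed.

Lemma ebase_norm (k : 'I_N) : `|ebase R k| <= 1.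
Proof.
apply/rV_normP => // i; rewrite !mxE /=.
by case: eqP; rewrite ?normr1 ?normr0.
Qed.

(** Two uses of the mean value theorem, first along [e_i] for [g z = u (b e_j + z) - u z], then
    along [e_j] for the [i]-th partial derivative, turn the quotient into a mixed derivative at a
    point near [x]. *)
Lemma second_difference_cvg u x (i j : 'I_N) :
  (\forall y \near x, derivable u y (ebase R i)) ->
  (\forall y \near x,
     derivable (fun z => 'D_(ebase R i) u z) y (ebase R j)) ->
  {for x, continuous (fun y =>
     'D_(ebase R j) (fun z => 'D_(ebase R i) u z) y)} ->
  (u (b *: ebase R j + (b *: ebase R i + x)) - u (b *: ebase R i + x)
   - (u (b *: ebase R j + x) - u x)) / b ^+ 2 @[b --> (0 : R)^'] -->
  'D_(ebase R j) (fun z => 'D_(ebase R i) u z) x.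
Proof.
set ei := ebase R i; set ej := ebase R j; set ui := fun z => 'D_ei u z.
move=> du dui cui; apply/cvgrPdist_le => e e0.
have cu' := (@cvgrPdist_le _ _ _ (nbhs x) (nbhs_filter x) _ _).1 cui e e0.
have /nbhs_ballP [r /= r0 near_r] : \forall y \near x,
  (derivable u y ei /\ derivable ui y ej) /\ `|'D_ej ui x - 'D_ej ui y| <= e.
  exact: (@filterI _ (nbhs x) _ _ _ (@filterI _ (nbhs x) _ _ _ du dui) cu').
near=> b.
have b0 : b != 0 by near: b; exact: nbhs_dnbhs_neq.
(* The intermediate points [s' e_j + s e_i + x] lie within [2 |b|] of [x]. *)
have br : `|b| < r / 2.
  by near: b; apply: dnbhs0_lt; rewrite divr_gt0.
have near_s (s s' : R) : `|s| <= `|b| -> `|s'| <= `|b| ->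
    ball x r (s' *: ej + (s *: ei + x)).
  move=> sb s'b; rewrite -ball_normE /ball_ /= distrC addrA addrK.
  rewrite (le_lt_trans (ler_normD _ _)) // !normrZ.
  rewrite (@le_lt_trans _ _ (`|b| + `|b|)) //; last by lra.
  by apply: lerD; rewrite -[leRHS]mulr1 ler_pM ?ebase_norm.
have near_s0 (s : R) : `|s| <= `|b| -> ball x r (s *: ei + x).
  by move=> sb; have := near_s s 0 sb; rewrite scale0r add0r normr0; apply.
pose g z := u (b *: ej + z) - u z.
have dg (s : R) : `|s| <= `|b| ->
  is_derive (s *: ei + x) ei g (ui (b *: ej + (s *: ei + x)) - ui (s *: ei + x)).
  move=> sb; apply: is_deriveB.
    by apply/is_derive_translate/derivableP/(near_r _ (near_s s b sb _)).1.1.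
  exact/derivableP/(near_r _ (near_s0 s sb)).1.1.
have [s sb E] := @line_mean_value g x i b
  (fun s h => @ex_derive _ _ _ _ _ _ _ (dg s h)).
have [s' s'b E'] := @line_mean_value ui (s *: ei + x) j b
  (fun s' h => (near_r _ (near_s s s' sb h)).1.2).
rewrite -/ei -/ej in E E'.
rewrite -[X in X / _]/(g (b *: ei + x) - g x) E.
rewrite (@derive_val _ _ _ _ _ _ _ (dg s sb)) E' -mulrA -expr2 mulfK ?expf_neq0 //.
exact: (near_r _ (near_s s s' sb s'b)).2.
Unshelve. all: by end_near. Qed.

(** The second difference is symmetric in [i] and [j], so both mixed derivatives are limits of one
    and the same expression. *)
Lemma derive_symmetric u x (i j : 'I_N) :
  (forall k, \forall y \near x, derivable u y (ebase R k)) ->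
  (forall k l, \forall y \near x,
     derivable (fun z => 'D_(ebase R k) u z) y (ebase R l)) ->
  (forall k l, {for x, continuous (fun y =>
     'D_(ebase R l) (fun z => 'D_(ebase R k) u z) y)}) ->
  'D_(ebase R j) (fun z => 'D_(ebase R i) u z) x =
  'D_(ebase R i) (fun z => 'D_(ebase R j) u z) x.
Proof.
move=> du ddu cu.
apply: (cvg_unique _ (second_difference_cvg (du i) (ddu i j) (cu i j))).
  exact: Rhausdorff.
apply/(cvg_trans _ (second_difference_cvg (du j) (ddu j i) (cu j i))).
apply: near_eq_cvg; near=> b.
by rewrite [b *: ebase R i + (_ + x)]addrCA; congr (_ / _); ring.
Unshelve. all: by end_near. Qed.

End PartialDerivatives.

(** * The second-order chain rule along curves in an open set *)

Section SecondOrderChainRule.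
Variables (R : realType) (N : nat) (U : set 'rV[R]_N) (u : 'rV[R]_N -> R).
Hypotheses (oU : open U) (u_C2 : Ck 2 U u).

Lemma nearU (P : 'rV[R]_N -> Prop) x : U x -> (forall y, U y -> P y) ->
  \forall y \near x, P y.
Proof.
by move=> Ux UP; near=> y; apply: UP; near: y; exact: open_nbhs_nbhs.
Unshelve. all: by end_near. Qed.

(** The first-order chain rule is applied to [u] at all [t] near 0, then at 0 to each partial
    derivative of [u]; the product rule with the velocities [v i] brings in the accelerations
    [w i]. *)
Lemma second_derive_curve (c : R -> 'rV[R]_N) (v : 'I_N -> R -> R)
    (w : 'I_N -> R) :
  U (c 0) ->
  (\forall t \near (0 : R), forall i, is_derive (t : R) 1 (fun s : R => c s 0 i) (v i t)) ->
  (forall i, is_derive (0 : R) 1 (v i) (w i)) ->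
  'D_1 (fun t : R => 'D_1 (fun s : R => u (c s)) t) 0 =
  \sum_i ((\sum_j 'D_(ebase R j) (fun z => 'D_(ebase R i) u z) (c 0) * v j 0) * v i 0
          + 'D_(ebase R i) u (c 0) * w i).
Proof.
move=> Uc0 dc dv.
have [_ D1] := u_C2.
have du i := (D1 i).1; have cu i := (D1 i).2.1.
have ddu i j := ((D1 i).2.2 j).1; have cdu i j := ((D1 i).2.2 j).2.1.
have dc0 := nbhs_singleton dc.
have c_cont : {for 0, continuous c}.
  apply/differentiable_continuous/derivable1_diffP/derivable_mxP => i j.
  by rewrite ord1; have := dc0 j.
have nU : \forall t \near (0 : R), U (c t).
  by apply: c_cont; exact: open_nbhs_nbhs.
have first (t : R) : (forall i, is_derive (t : R) 1 (fun s : R => c s 0 i) (v i t)) ->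
    U (c t) -> is_derive (t : R) 1 (fun s : R => u (c s))
      (\sum_i 'D_(ebase R i) u (c t) * v i t).
  move=> dct Uct; apply: is_derive_curve => // i.
    by apply: nearU => // y Uy; exact: du.
  exact: cu.
(* The first-order formula holds only for [t] near 0, which is enough to determine the outer
   derivative at 0. *)
have -> : 'D_1 (fun t : R => 'D_1 (fun s : R => u (c s)) t) 0 =
    'D_1 (\sum_i (fun t : R => 'D_(ebase R i) u (c t) * v i t)) 0.
  apply: near_eq_derive; near=> t.
  rewrite fct_sumE; apply: (@derive_val _ _ _ _ _ _ _ (first t _ _)).
    by near: t.
  by near: t.
have second i : is_derive (0 : R) 1 (fun t : R => 'D_(ebase R i) u (c t) * v i t)
   ((\sum_j 'D_(ebase R j) (fun z => 'D_(ebase R i) u z) (c 0) * v j 0) * v i 0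
          + 'D_(ebase R i) u (c 0) * w i).
  have dDu : is_derive (0 : R) 1 (fun t : R => 'D_(ebase R i) u (c t))
      (\sum_j 'D_(ebase R j) (fun z => 'D_(ebase R i) u z) (c 0) * v j 0).
    apply: (@is_derive_curve _ _ (fun z => 'D_(ebase R i) u z)) => // j.
      by apply: nearU => // y Uy; exact: ddu.
    exact: cdu.
  have H := is_deriveM dDu (dv i); apply: (is_derive_eq H).
  by rewrite addrC /GRing.scale /= [v i 0 * _]mulrC.
by apply: derive_val; apply: is_derive_sum.
Unshelve. all: by end_near. Qed.

Lemma second_derive_comp (V : normedModType R) (e : V) (p : V -> 'rV[R]_N)
    (v : 'I_N -> R -> R) (w : 'I_N -> R) :
  U (p 0) ->
  (\forall t \near (0 : R), forall i,
     is_derive (t : R) 1 (fun s : R => p (s *: e) 0 i) (v i t)) ->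
  (forall i, is_derive (0 : R) 1 (v i) (w i)) ->
  'D_e (fun x => 'D_e (fun y => u (p y)) x) 0 =
  \sum_i ((\sum_j 'D_(ebase R j) (fun z => 'D_(ebase R i) u z) (p 0) * v j 0) * v i 0
          + 'D_(ebase R i) u (p 0) * w i).
Proof.
have line (F : V -> R) (s : R) : 'D_1 (fun t : R => F (t *: e)) s = 'D_e F (s *: e).
  by have := derive_line F e 0 s; rewrite addr0; under eq_fun do rewrite addr0.
move=> Up dp dv; rewrite -[X in 'D_e _ X](scale0r e) -line.
under eq_fun do rewrite -line.
rewrite (@second_derive_curve (fun t => p (t *: e)) v w) ?scale0r //.
Qed.

End SecondOrderChainRule.

(** * Quaternions in real coordinates *)

Section QuaternionCoordinates.
Variable R : realType.
Implicit Types (x y p : quat R) (r t : R) (c d : 'I_4).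

Definition qcoord x c : R := [:: q0 x; q1 x; q2 x; q3 x]`_c.

Definition qunit c : quat R :=
  Quat (c == 0 :> nat)%:R (c == 1 :> nat)%:R (c == 2 :> nat)%:R (c == 3 :> nat)%:R.


Lemma ord4P (P : 'I_4 -> Prop) : P 0 -> P 1 -> P 2 -> P 3 -> forall c, P c.
Proof.
move=> P0 P1 P2 P3 [[|[|[|[|//]]]] lt4].
- by rewrite (_ : Ordinal lt4 = 0) //; apply: val_inj.
- by rewrite (_ : Ordinal lt4 = 1) //; apply: val_inj.
- by rewrite (_ : Ordinal lt4 = 2) //; apply: val_inj.
- by rewrite (_ : Ordinal lt4 = 3) //; apply: val_inj.
Qed.

Lemma sum_ord4 (M : nmodType) (F : 'I_4 -> M) :
  \sum_c F c = F 0 + F 1 + F 2 + F 3.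
Proof.
rewrite !big_ord_recr big_ord0 /= add0r.
by do 3?congr (_ + _); congr F; apply: val_inj.
Qed.

Lemma qcoordD x y c : qcoord (x + y) c = qcoord x c + qcoord y c.
Proof. by elim/ord4P: c. Qed.

Lemma qcoord0 c : qcoord 0 c = 0.
Proof. by elim/ord4P: c. Qed.

Lemma qcoord_sum I (r : seq I) (P : pred I) (F : I -> quat R) c :
  qcoord (\sum_(i <- r | P i) F i) c = \sum_(i <- r | P i) qcoord (F i) c.
Proof.
by apply: (big_morph (qcoord^~ c)) => [x y|]; rewrite ?qcoordD ?qcoord0.
Qed.

Lemma qcoordZ r x c : qcoord (realq r * x) c = r * qcoord x c.
Proof. by elim/ord4P: c; rewrite /qcoord /=; ring. Qed.

Lemma realq_sum I (r : seq I) (P : pred I) (F : I -> R) :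
  realq (\sum_(i <- r | P i) F i) = \sum_(i <- r | P i) realq (F i).
Proof.
apply: (big_morph (@realq R)) => // x y.
by congr Quat => /=; ring.
Qed.

Lemma conjqK x : conjq (conjq x) = x.
Proof. by case: x => *; congr Quat => /=; ring. Qed.

(** With [L_x] the real matrix of left multiplication by [x], this reads [L_x L_y^T = L_(x conj y)]:
    the transpose of [L_y] is [L_(conj y)]. *)
Lemma sum_qcoord_qunit x y c d :
  \sum_k qcoord (x * qunit k) c * qcoord (y * qunit k) d =
  qcoord (x * conjq y * qunit d) c.
Proof.
rewrite sum_ord4; elim/ord4P: c; elim/ord4P: d; rewrite /qcoord /=; ring.
Qed.

Lemma sum_qunit_conj x : \sum_k qunit k * x * qunit k = - (conjq x *+ 2).
Proof. by rewrite sum_ord4 mulr2n; congr Quat => /=; ring. Qed.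

(* The denominator is [|1 - t p|^2]. *)
Lemma qcoord_mobius x b p t c :
  qcoord ((x + realq t * b) * (1 - realq t * p)^-1) c =
  (qcoord x c + qcoord (b - x * conjq p) c * t
     - qcoord (b * conjq p) c * (t * t)) *
  (1 - (q0 p *+ 2) * t + sqnormq p * (t * t))^-1.
Proof.
have E : sqnormq (1 - realq t * p) = 1 - (q0 p *+ 2) * t + sqnormq p * (t * t).
  by rewrite /sqnormq /= mulr2n; ring.
rewrite -[_^-1]/(Defs.invq _) /Defs.invq E; set D := _^-1.
elim/ord4P: c; rewrite /qcoord /=; ring.
Qed.

(** The left side is the linear Taylor coefficient of the real quotient in [qcoord_mobius]; the
    right side is that of [(x + t b)(1 + t p + ...)]. *)
Lemma mobius_velocity x b p c :
  qcoord (b - x * conjq p) c + q0 p *+ 2 * qcoord x c = qcoord (b + x * p) c.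
Proof. by elim/ord4P: c; rewrite /qcoord /=; ring. Qed.

(** Likewise for the coefficient of [t^2], which is [b p + x p^2], that is, half the second
    derivative at 0. *)
Lemma mobius_acceleration x b p c :
  - qcoord (b * conjq p) c + q0 p *+ 2 * qcoord (b - x * conjq p) c
    + ((q0 p *+ 2) ^+ 2 - sqnormq p) * qcoord x c =
  qcoord ((b + x * p) * p) c.
Proof. by elim/ord4P: c; rewrite /qcoord /sqnormq /=; ring. Qed.

End QuaternionCoordinates.

Section PointwiseDerivatives.
Variables (R : realType) (V : normedModType R).
Implicit Types (f g : V -> R) (x e : V) (a b : R).

Lemma is_derive_add f g x e a b :
  is_derive x e f a -> is_derive x e g b ->
  is_derive x e (fun y => f y + g y) (a + b).
Proof. by move=> da db; exact: is_deriveD. Qed.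

Lemma is_derive_opp f x e a :
  is_derive x e f a -> is_derive x e (fun y => - f y) (- a).
Proof. by move=> da; exact: is_deriveN. Qed.

Lemma is_derive_mul f g x e a b :
  is_derive x e f a -> is_derive x e g b ->
  is_derive x e (fun y => f y * g y) (a * g x + f x * b).
Proof.
move=> da db; have H := is_deriveM da db; apply: (is_derive_eq H).
by rewrite /GRing.scale /=; ring.
Qed.

Lemma is_derive_inv (f : R -> R) (t a : R) :
  f t != 0 -> is_derive t 1 f a ->
  is_derive t 1 (fun y => (f y)^-1) (- a / f t ^+ 2).
Proof.
move=> ft0 da; have H := is_deriveV ft0 da; apply: (is_derive_eq H).
by rewrite /GRing.scale /= !mulNr mulrC.
Qed.

End PointwiseDerivatives.

(** * First and second derivatives of a quotient of quadratic polynomials *)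

Section RationalCurve.
Variables (R : realType) (c0 c1 c2 r p : R).
Let num (t : R) := c0 + c1 * t - c2 * (t * t).
Let den (t : R) := 1 - r * t + p * (t * t).

(** Kept in product form, with squares written as products, so that the product rule can
    differentiate it once more. *)
Definition rat_velocity (t : R) : R :=
  (c1 - c2 * (t + t)) * (den t)^-1
  + num t * (- (- r + p * (t + t)) * ((den t)^-1 * (den t)^-1)).

Let dnum (t : R) : is_derive t 1 num (c1 - c2 * (t + t)).
Proof.
have dt : is_derive t (1 : R) (fun s : R => s) 1 by exact: is_derive_id.
have dc (k : R) : is_derive t (1 : R) (fun=> k) 0 by exact: is_derive_cst.
apply: (is_derive_eq (is_derive_add (is_derive_add (dc c0) (is_derive_mul (dc c1) dt))
  (is_derive_opp (is_derive_mul (dc c2) (is_derive_mul dt dt))))).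
rewrite /=; ring.
Qed.

Let dden (t : R) : is_derive t 1 den (- r + p * (t + t)).
Proof.
have dt : is_derive t (1 : R) (fun s : R => s) 1 by exact: is_derive_id.
have dc (k : R) : is_derive t (1 : R) (fun=> k) 0 by exact: is_derive_cst.
apply: (is_derive_eq (is_derive_add
  (is_derive_add (dc 1) (is_derive_opp (is_derive_mul (dc r) dt)))
  (is_derive_mul (dc p) (is_derive_mul dt dt)))).
rewrite /=; ring.
Qed.

Let dinvden (t : R) : den t != 0 ->
  is_derive t 1 (fun s => (den s)^-1) (- (- r + p * (t + t)) * ((den t)^-1 * (den t)^-1)).
Proof.
move=> d0; apply: (is_derive_eq (is_derive_inv d0 (dden t))).
by rewrite expr2 invfM.
Qed.

Lemma is_derive_rat (t : R) : den t != 0 ->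
  is_derive t 1 (fun s : R => num s * (den s)^-1) (rat_velocity t).
Proof. by move=> d0; exact: (is_derive_mul (dnum t) (dinvden d0)). Qed.

(** Near 0 the inverse of [den] is [1 + r t + (r^2 - p) t^2 + ...]; the value is twice the
    coefficient of [t^2] in the quotient. *)
Lemma is_derive_rat_velocity :
  is_derive (0 : R) 1 rat_velocity (2 * (- c2 + r * c1 + (r ^+ 2 - p) * c0)).
Proof.
have d0 : den 0 = 1 by rewrite /den; ring.
have di : is_derive (0 : R) 1 (fun s => (den s)^-1) r.
  by apply: is_derive_eq (dinvden _ ) _; rewrite d0 ?oner_neq0 // invr1; ring.
have dt : is_derive (0 : R) (1 : R) (fun s : R => s) 1 by exact: is_derive_id.
have dc (k : R) : is_derive (0 : R) (1 : R) (fun=> k) 0 by exact: is_derive_cst.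
have d2t := is_derive_add dt dt.
apply: (is_derive_eq (is_derive_add
  (is_derive_mul (is_derive_add (dc c1) (is_derive_opp (is_derive_mul (dc c2) d2t))) di)
  (is_derive_mul (dnum 0) (is_derive_mul (is_derive_opp
     (is_derive_add (dc (- r)) (is_derive_mul (dc p) d2t))) (is_derive_mul di di))))).
rewrite /= d0 invr1 /num; ring.
Qed.

Lemma rat_velocity0 : rat_velocity 0 = c1 + r * c0.
Proof. by rewrite /rat_velocity /num (_ : den 0 = 1) ?invr1 /den; ring. Qed.

Lemma den_neq0_near : \forall t \near (0 : R), den t != 0.
Proof.
have cd : {for 0, continuous den}.
  by apply/differentiable_continuous/derivable1_diffP; have := dden 0.
have d0 : den 0 != 0 by rewrite /den !mulr0 subr0 addr0 oner_neq0.
exact: (cvgr_neq0 _ cd d0).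
Qed.

End RationalCurve.

(** * Real versus quaternionic coordinates, and openness of the ball *)

Section RealCoordinates.
Variables (R : realType) (n : nat).
Local Notation V := 'rV[R]_(4 * n).

Lemma cidx_qidx (l : 'I_n) (c : 'I_4) : qidx (cidx l c) = l.
Proof. by apply: val_inj; rewrite /= mulnC divnMDl // divn_small ?addn0. Qed.

Lemma cidx_mod (l : 'I_n) (c : 'I_4) : (cidx l c %% 4)%N = c.
Proof. by rewrite /= mulnC modnMDl modn_small. Qed.

Definition ccomp (k : 'I_(4 * n)) : 'I_4 := Ordinal (ltn_pmod k (isT : 0 < 4)%N).

Lemma cidx_ccomp (k : 'I_(4 * n)) : cidx (qidx k) (ccomp k) = k.
Proof. by apply: val_inj; rewrite /= [RHS](divn_eq k 4) mulnC. Qed.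

Lemma ccomp_cidx (l : 'I_n) (c : 'I_4) : ccomp (cidx l c) = c.
Proof. by apply: val_inj; rewrite /= cidx_mod. Qed.

Lemma cidx_eq (l m : 'I_n) (c d : 'I_4) :
  (cidx l c == cidx m d) = (l == m) && (c == d).
Proof.
apply/eqP/andP => [E|[/eqP -> /eqP ->] //].
have := congr1 (@qidx n) E; rewrite !cidx_qidx => ->; split=> //.
by apply/eqP/val_inj; rewrite /= -(cidx_mod l c) E cidx_mod.
Qed.

Lemma sum_cidx (M : nmodType) (F : 'I_(4 * n) -> M) :
  \sum_k F k = \sum_l \sum_c F (cidx l c).
Proof.
rewrite pair_big /= (reindex (fun p : 'I_n * 'I_4 => cidx p.1 p.2)) //.
exists (fun k => (qidx k, ccomp k)) => [[l c]|k] _ /=.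
  by rewrite cidx_qidx ccomp_cidx.
exact: cidx_ccomp.
Qed.

Lemma ofH_cidx (q : 'cV[quat R]_n) l c : ofH q 0 (cidx l c) = qcoord (q l 0) c.
Proof. by rewrite !mxE cidx_qidx cidx_mod. Qed.

Lemma qcoord_toH (x : V) l c : qcoord (toH x l 0) c = x 0 (cidx l c).
Proof. by rewrite mxE; elim/ord4P: c. Qed.

Lemma toH_scale_ebase (t : R) (m l : 'I_n) (c : 'I_4) :
  toH (t *: ebase R (cidx m c)) l 0 = realq t * (if l == m then qunit R c else 0).
Proof.
rewrite !mxE eqxx /= !cidx_eq; case: (l == m) => /=; last first.
  by congr Quat => /=; ring.
by elim/ord4P: c; congr Quat => /=; ring.
Qed.

Lemma sqnormHE (q : 'cV[quat R]_n) : sqnormH q = \sum_l sqnormq (q l 0).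
Proof.
rewrite /sqnormH mxE; apply: (big_ind2 (fun x y => q0 x = y)) => //.
  by move=> x y z t <- <-.
by move=> l _; rewrite !mxE /sqnormq /=; ring.
Qed.

Lemma sqnormqE (x : quat R) : sqnormq x = \sum_c qcoord x c ^+ 2.
Proof. by rewrite sum_ord4. Qed.

Lemma sqnormH_toH (x : V) : sqnormH (toH x) = \sum_k x 0 k ^+ 2.
Proof.
rewrite sqnormHE sum_cidx; apply: eq_bigr => l _; rewrite sqnormqE.
by apply: eq_bigr => c _; rewrite qcoord_toH.
Qed.

Lemma open_unitball : open (@unitball R n).
Proof.
have -> : @unitball R n = (fun x : V => \sum_k x 0 k ^+ 2) @^-1` [set r | r < 1].
  by apply/seteqP; split=> x; rewrite /unitball /= sqnormH_toH.
apply: open_comp; last exact: open_lt.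
move=> x _; apply: cvg_big; [exact: add_continuous|exact: nbhs_filter|move=> i _].
apply: (@cvg_comp _ _ _ (fun y : V => y 0 i) (fun r : R => r ^+ 2) _ _ _
         (@coord_continuous _ _ _ 0 i x)).
exact: exprn_continuous.
Qed.

End RealCoordinates.

(** * The first two derivatives of the automorphisms at the origin *)

Section InvolutionDerivatives.
Variables (R : realType) (n : nat) (a : 'cV[quat R]_n).
Hypothesis a_lt1 : sqnormH a < 1.
Let N := sqnormH a.
Let s := s_ a.

(* At [a = 0] this is [0], which is harmless: it only ever multiplies [a a^*],
   so that [A = kappa a a^* + s I] holds in all cases. *)
Definition kappa : R := (1 - s_ a) * (sqnormH a)^-1.

Lemma AmxE l m :
  Amx a l m = realq kappa * (a l 0 * conjq (a m 0)) + realq s * (l == m)%:R.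
Proof.
rewrite /Amx; case: eqVneq => [a0|_]; last by rewrite !mxE big_ord1 !mxE.
have N0 : sqnormH a = 0.
  rewrite sqnormHE big1 // => i _; apply/eqP.
  by rewrite sqnormq_eq0 a0 mxE.
rewrite a0 !mxE mul0r mulr0 add0r /s /s_ N0 subr0 sqrtr1.
by rewrite -/(1 : quat R) mul1r.
Qed.

Lemma s_sqr : s ^+ 2 = 1 - N.
Proof. by rewrite sqr_sqrtr // subr_ge0 ltW. Qed.

Lemma sqnormq_ge0 (x : quat R) : 0 <= sqnormq x.
Proof. by rewrite /sqnormq !addr_ge0 ?sqr_ge0. Qed.

Lemma kappa_norm : kappa * N = 1 - s.
Proof.
have [N0|N0] := eqVneq N 0; last by rewrite /kappa mulfVK.
by rewrite N0 mulr0 /s /s_ -/N N0 subr0 sqrtr1 subrr.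
Qed.

(* The differential of [phi a] at [0] is the left multiplication by the matrix
   [dphi = a a^* - A]. *)
Definition dphi l m : quat R :=
  realq (1 - kappa) * (a l 0 * conjq (a m 0)) - realq s * (l == m)%:R.

(** For [e] the unit [c] placed in slot [m], [pole] is [a^* e] and [slant] is the [l]-th entry of
    [- A e], so that [phi_a (t e)] has entries [(a_l + t slant) (1 - t pole)^-1]. *)
Let pole m c : quat R := conjq (a m 0) * qunit R c.
Let slant l m c : quat R :=
  - (Amx a l m * qunit R c).

Lemma slant_velocity l m c : slant l m c + a l 0 * pole m c = dphi l m * qunit R c.
Proof.
rewrite /slant AmxE /dphi /pole.
have -> : realq (1 - kappa) = 1 - realq kappa.
  by congr Quat => /=; ring.
rewrite [a l 0 * (_ * _)]mulrA -mulNr -mulrDl; congr (_ * _).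
by rewrite mulrBl mul1r opprD addrC addrA.
Qed.


Lemma realq_central (r : R) (x : quat R) : realq r * x = x * realq r.
Proof. by congr Quat => /=; ring. Qed.

(** If [N = 0] then [a = 0] and the outer product vanishes. Scalar identities multiplying [a a^*]
    thus need checking only for [N != 0]. *)
Lemma realq_mul_outer_eq0 (r : R) :
  (N != 0 -> r = 0) -> forall l m, realq r * (a l 0 * conjq (a m 0)) = 0.
Proof.
move=> r0 l m; have [N0|/r0 ->] := eqVneq N 0; last first.
  by congr Quat => /=; ring.
have al : a l 0 = 0.
  apply/eqP; rewrite -sqnormq_eq0; move: N0; rewrite /N sqnormHE => /eqP.
  rewrite psumr_eq0 => [/allP /(_ l)|i _]; last exact: sqnormq_ge0.
  by rewrite mem_index_enum => /(_ isT).
by rewrite al mul0r mulr0.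
Qed.

(** With [al = 1 - kappa], the product expands to [(al^2 N - 2 al s) a a^* + s^2 I]. The identity
    [kappa N = 1 - s] reduces the first coefficient to [- al s (1 + s)], which is [- s^2] because
    [kappa (1 + s) = 1] when [N != 0]. *)
Lemma dphi_gram l l' :
  \sum_m dphi l m * conjq (dphi l' m) =
  realq (s ^+ 2) * ((l == l')%:R - a l 0 * conjq (a l' 0)).
Proof.
pose al := 1 - kappa; pose X := a l 0 * conjq (a l' 0).
have term m : dphi l m * conjq (dphi l' m) =
    realq (al ^+ 2 * sqnormq (a m 0)) * X
    - (if m == l' then realq (al * s) * (a l 0 * conjq (a m 0)) else 0)
    - (if m == l then realq (al * s) * (a m 0 * conjq (a l' 0)) else 0)
    + (if m == l then realq (s ^+ 2) * (m == l')%:R else 0).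
  rewrite /dphi -/al /X [l == m]eq_sym [l' == m]eq_sym.
  by case: (m == l); case: (m == l'); congr Quat; rewrite /= /sqnormq; ring.
rewrite (eq_bigr _ (fun m _ => term m)) big_split /= !sumrB -!big_mkcond /=.
rewrite !big_pred1_eq -mulr_suml -realq_sum -mulr_sumr -sqnormHE -/N -/X.
have E0 : realq (al * s * (1 + s) - s ^+ 2) * X = 0.
  apply: realq_mul_outer_eq0 => N0; rewrite /al.
  have NE : N = 1 - s ^+ 2 by rewrite s_sqr subKr.
  (* This is [kappa N = 1 - s] with [N = (1 - s)(1 + s)]; the factor [1 - s] is nonzero since
     [s = 1] would give [N = 0]. *)
  have : (1 - s) * (kappa * (1 + s) - 1) = 0.
    have -> : (1 - s) * (kappa * (1 + s) - 1) = kappa * (1 - s ^+ 2) - (1 - s) by ring.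
    by rewrite -NE kappa_norm subrr.
  move/eqP; rewrite mulf_eq0 => /orP[|] /eqP s1.
    have NE' : N = (1 - s) * (1 + s) by rewrite NE; ring.
    by case/eqP: N0; rewrite NE' s1 mul0r.
  have -> : (1 - kappa) * s * (1 + s) - s ^+ 2 = - s * (kappa * (1 + s) - 1) by ring.
  by rewrite s1 mulr0.
have E1 : realq (al ^+ 2 * N) * X - realq (al * s) * X - realq (al * s) * X
    = - realq (s ^+ 2) * X - realq (al * s * (1 + s) - s ^+ 2) * X.
  have -> : al ^+ 2 * N = al * (s - s ^+ 2).
    rewrite expr2 -mulrA; congr (_ * _).
    by rewrite mulrBl kappa_norm mul1r -[X in X - _ = _](subKr 1) -s_sqr; ring.
  by congr Quat => /=; ring.
by rewrite E1 E0 subr0 mulrBr mulNr addrC.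
Qed.

Lemma dphi_apply l : \sum_m dphi l m * a m 0 = - (realq (s ^+ 2) * a l 0).
Proof.
have term m : dphi l m * a m 0 = realq ((1 - kappa) * sqnormq (a m 0)) * a l 0
    - (if m == l then realq s * a m 0 else 0).
  rewrite /dphi [l == m]eq_sym.
  by case: (m == l); congr Quat; rewrite /= /sqnormq; ring.
rewrite (eq_bigr _ (fun m _ => term m)) sumrB -big_mkcond big_pred1_eq /=.
rewrite -mulr_suml -realq_sum -mulr_sumr -sqnormHE -/N -mulrBl -[RHS]mulNr.
congr (_ * _).
have -> : (1 - kappa) * N = s - s ^+ 2.
  by rewrite mulrBl kappa_norm mul1r -[X in X - _ = _](subKr 1) -s_sqr; ring.
by congr Quat => /=; ring.
Qed.

Definition phi_velocity (l m : 'I_n) (c d : 'I_4) : R := qcoord (dphi l m * qunit R c) d.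

(** Twice the coefficient given by [mobius_acceleration]: velocity times pole. *)
Definition phi_acceleration (l m : 'I_n) (c d : 'I_4) : R :=
  2 * qcoord (dphi l m * qunit R c * pole m c) d.

Lemma sum_phi_velocity (l l' : 'I_n) (d d' : 'I_4) :
  \sum_m \sum_c phi_velocity l m c d * phi_velocity l' m c d' =
  (1 - N) * (((l == l') && (d == d'))%:R
             - qcoord (a l 0 * conjq (a l' 0) * qunit R d') d).
Proof.
under eq_bigr => m _ do rewrite sum_qcoord_qunit.
rewrite -qcoord_sum -mulr_suml dphi_gram -mulrA qcoordZ s_sqr; congr (_ * _).
rewrite mulrBl qcoordD.
have -> : qcoord (- (a l 0 * conjq (a l' 0) * qunit R d')) d =
          - qcoord (a l 0 * conjq (a l' 0) * qunit R d') d.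
  by elim/ord4P: d.
congr (_ - _); case: (l == l'); last by rewrite mul0r qcoord0.
by rewrite mul1r; elim/ord4P: d; elim/ord4P: d'.
Qed.

(** The sum over units of [c conj(a_m) c] is [- 2 a_m], so the total is [- 4] times [dphi] applied
    to [a], and [dphi_apply] gives [4 s^2 a]. *)
Lemma sum_phi_acceleration (l : 'I_n) (d : 'I_4) :
  \sum_m \sum_c phi_acceleration l m c d = 4 * (1 - N) * qcoord (a l 0) d.
Proof.
have term m : \sum_c phi_acceleration l m c d = - 4 * qcoord (dphi l m * a m 0) d.
  rewrite -mulr_sumr -qcoord_sum.
  under eq_bigr => c _ do rewrite /pole -mulrA [qunit R c * _]mulrA.
  rewrite -mulr_sumr sum_qunit_conj conjqK mulrN mulrnAr mulr2n.
  by elim/ord4P: d; rewrite /qcoord /=; ring.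
rewrite (eq_bigr _ (fun m _ => term m)) {term} -mulr_sumr -qcoord_sum dphi_apply s_sqr.
rewrite -mulrA -qcoordZ -/N.
by elim/ord4P: d; rewrite /qcoord /=; ring.
Qed.

Lemma phi_line (t : R) (m l : 'I_n) (c : 'I_4) :
  phi a (toH (t *: ebase R (cidx m c))) l 0 =
  (a l 0 + realq t * slant l m c) * (1 - realq t * pole m c)^-1.
Proof.
have sum1 (F : 'I_n -> quat R) :
    \sum_k F k * toH (t *: ebase R (cidx m c)) k 0 = realq t * (F m * qunit R c).
  rewrite (bigD1 m) //= toH_scale_ebase eqxx big1 ?addr0 => [|k /negbTE km].
    by rewrite mulrA -realq_central mulrA.
  by rewrite toH_scale_ebase km !mulr0.
rewrite /phi !mxE big_ord1 !mxE mulr1n; congr (_ * (1 - _)^-1).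
  by rewrite sum1 /slant mulrN.
by rewrite /pole -(sum1 (fun k => conjq (a k 0))); apply: eq_bigr => k _; rewrite !mxE.
Qed.

End InvolutionDerivatives.

(** * The Laplacian of a real function composed with the automorphism *)

Section PhiLine.
Variables (R : realType) (n : nat) (a : 'rV[R]_(4 * n)).
Hypothesis a_in : unitball a.

Lemma phiR0 : phiR a 0 = a.
Proof.
rewrite /phiR /phi (_ : toH 0 = 0) ?mulmx0 ?subr0.
  by rewrite mxE subr0 invr1 mulmx1 toHK.
by apply/colP => l; rewrite !mxE.
Qed.

Definition phi_vel (i k : 'I_(4 * n)) : R :=
  phi_velocity (toH a) (qidx i) (qidx k) (ccomp k) (ccomp i).

Definition phi_acc (i k : 'I_(4 * n)) : R :=
  phi_acceleration (toH a) (qidx i) (qidx k) (ccomp k) (ccomp i).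

(** Entry of the real matrix of left multiplication by the quaternionic matrix [a a^*]. *)
Definition outer (i j : 'I_(4 * n)) : R :=
  qcoord (toH a (qidx i) 0 * conjq (toH a (qidx j) 0) * qunit R (ccomp j)) (ccomp i).

Lemma sum_phi_vel (i j : 'I_(4 * n)) :
  \sum_k phi_vel i k * phi_vel j k =
  (1 - sqnormH (toH a)) * ((i == j)%:R - outer i j).
Proof.
have -> : (i == j) = ((qidx i == qidx j) && (ccomp i == ccomp j)).
  by rewrite -cidx_eq !cidx_ccomp.
rewrite sum_cidx.
rewrite -sum_phi_velocity //; apply: eq_bigr => m _; apply: eq_bigr => c _.
by rewrite /phi_vel cidx_qidx ccomp_cidx.
Qed.

Lemma sum_phi_acc (i : 'I_(4 * n)) :
  \sum_k phi_acc i k = 4 * (1 - sqnormH (toH a)) * a 0 i.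
Proof.
rewrite sum_cidx -[in RHS](cidx_ccomp i) -qcoord_toH -sum_phi_acceleration //.
apply: eq_bigr => m _; apply: eq_bigr => c _.
by rewrite /phi_acc cidx_qidx ccomp_cidx.
Qed.

Lemma phiR_line (k : 'I_(4 * n)) : exists v : 'I_(4 * n) -> R -> R,
  [/\ \forall t \near (0 : R), forall i,
        is_derive (t : R) 1 (fun s : R => phiR a (s *: ebase R k) 0 i) (v i t),
      forall i, v i 0 = phi_vel i k &
      forall i, is_derive (0 : R) 1 (v i) (phi_acc i k)].
Proof.
pose A := toH a; pose p := conjq (A (qidx k) 0) * qunit R (ccomp k).
pose b l := - (Amx A l (qidx k) * qunit R (ccomp k)).
have bp l : b l + A l 0 * p = dphi A l (qidx k) * qunit R (ccomp k).
  exact: slant_velocity.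
(* The coefficients are those read off from [qcoord_mobius] with [x = a_l]. *)
exists (fun i => rat_velocity (qcoord (A (qidx i) 0) (ccomp i))
   (qcoord (b (qidx i) - A (qidx i) 0 * conjq p) (ccomp i))
   (qcoord (b (qidx i) * conjq p) (ccomp i)) (q0 p *+ 2) (sqnormq p)).
split=> [|i|i].
- near=> t => i.
  have E r : phiR a (r *: ebase R k) 0 i =
      qcoord ((A (qidx i) 0 + realq r * b (qidx i)) * (1 - realq r * p)^-1) (ccomp i).
    by rewrite -[in LHS](cidx_ccomp i) -[in LHS](cidx_ccomp k) /phiR ofH_cidx phi_line.
  under eq_fun do rewrite E qcoord_mobius.
  by apply: is_derive_rat; near: t; exact: den_neq0_near.
- by rewrite rat_velocity0 mobius_velocity bp.
- apply: (is_derive_eq (is_derive_rat_velocity _ _ _ _ _)).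
  by rewrite mobius_acceleration bp.
Unshelve. all: by end_near. Qed.

(** After the chain rule, the sum over directions [k] is moved inside: the Hessian is contracted
    with the Gram matrix of the velocities, the gradient with the summed accelerations. *)
Lemma laplace_phiR (u : 'rV[R]_(4 * n) -> R) : Ck 2 (@unitball R n) u ->
  \sum_k 'D_(ebase R k) (fun x => 'D_(ebase R k) (fun y => u (phiR a y)) x) 0 =
  (1 - sqnormH (toH a)) *
  (\sum_i 'D_(ebase R i) (fun z => 'D_(ebase R i) u z) a
   - \sum_i \sum_j outer i j * 'D_(ebase R j) (fun z => 'D_(ebase R i) u z) a
   + 4 * \sum_i a 0 i * 'D_(ebase R i) u a).
Proof.
move=> u_C2; pose H i j := 'D_(ebase R j) (fun z => 'D_(ebase R i) u z) a.
pose G i := 'D_(ebase R i) u a.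
have step k : 'D_(ebase R k) (fun x => 'D_(ebase R k) (fun y => u (phiR a y)) x) 0 =
    \sum_i ((\sum_j H i j * phi_vel j k) * phi_vel i k + G i * phi_acc i k).
  have [v [dv v0 dv0]] := phiR_line k.
  rewrite (second_derive_comp (@open_unitball R n) u_C2 _ dv dv0) ?phiR0 //.
  by apply: eq_bigr => i _; rewrite v0; under eq_bigr do rewrite v0.
rewrite (eq_bigr _ (fun k _ => step k)) exchange_big /= mulrDr mulrBr.
rewrite !mulr_sumr -sumrB -big_split /=; apply: eq_bigr => i _.
rewrite big_split /= -[in X in _ + X]mulr_sumr sum_phi_acc; congr (_ + _); last first.
  by rewrite /G; ring.
under eq_bigr => k _ do rewrite mulr_suml.
rewrite exchange_big /=.
have term j : \sum_k H i j * phi_vel j k * phi_vel i k =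
   (if j == i then (1 - sqnormH (toH a)) * H i i else 0)
   - (1 - sqnormH (toH a)) * (outer i j * H i j).
  have -> : \sum_k H i j * phi_vel j k * phi_vel i k =
      H i j * \sum_k phi_vel i k * phi_vel j k.
    by rewrite mulr_sumr; apply: eq_bigr => k _; ring.
  rewrite sum_phi_vel [j == i]eq_sym; case: eqVneq => [->|_] /=;
    by move: (H _ _) (outer _ _) (sqnormH _) => x y z; ring.
rewrite (eq_bigr _ (fun j _ => term j)) sumrB; congr (_ - _).
  by rewrite -big_mkcond big_pred1_eq.
by rewrite mulr_sumr.
Qed.

End PhiLine.

(** * The complex vector fields *)

Section ComplexPartialDerivatives.
Variables (R : realType) (M : nat).
Local Notation V := 'rV[R]_M.
Implicit Types (F G : V -> R[i]) (x : V) (k : 'I_M) (a b : R[i]).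

(** Unlike an equation on [pd], this also records derivability of both parts, which the product rule
    requires. *)
Definition is_pd k F x a :=
  is_derive x (ebase R k) (fun y => complex.Re (F y)) (complex.Re a) /\
  is_derive x (ebase R k) (fun y => complex.Im (F y)) (complex.Im a).

Lemma is_pd_val k F x a : is_pd k F x a -> pd k F x = a.
Proof.
by case=> dRe dIm; rewrite /pd !derive_val; case: a {dRe dIm}.
Qed.

Lemma is_pd_cst k a x : is_pd k (fun=> a) x 0.
Proof. by split; exact: is_derive_cst. Qed.

Lemma is_pd_add k F G x a b :
  is_pd k F x a -> is_pd k G x b -> is_pd k (fun y => F y + G y) x (a + b).
Proof.
move=> [Fr Fi] [Gr Gi]; split; rewrite raddfD /=.
  under eq_fun do rewrite raddfD; exact: is_derive_add.
under eq_fun do rewrite raddfD; exact: is_derive_add.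
Qed.

Lemma is_pd_opp k F x a : is_pd k F x a -> is_pd k (fun y => - F y) x (- a).
Proof.
move=> [Fr Fi]; split; rewrite raddfN /=.
  under eq_fun do rewrite raddfN; exact: is_derive_opp.
under eq_fun do rewrite raddfN; exact: is_derive_opp.
Qed.

Lemma is_pd_mul k F G x a b :
  is_pd k F x a -> is_pd k G x b ->
  is_pd k (fun y => F y * G y) x (a * G x + F x * b).
Proof.
have ReM (z w : R[i]) : complex.Re (z * w) =
    complex.Re z * complex.Re w - complex.Im z * complex.Im w by case: z w => ? ? [].
have ImM (z w : R[i]) : complex.Im (z * w) =
    complex.Re z * complex.Im w + complex.Im z * complex.Re w by case: z w => ? ? [].
move=> [Fr Fi] [Gr Gi]; split; rewrite raddfD /= ?ReM ?ImM.
  under eq_fun do rewrite ReM.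
  have H := is_derive_add (is_derive_mul Fr Gr) (is_derive_opp (is_derive_mul Fi Gi)).
  by apply: (is_derive_eq H); ring.
under eq_fun do rewrite ImM.
have H := is_derive_add (is_derive_mul Fr Gi) (is_derive_mul Fi Gr).
by apply: (is_derive_eq H); ring.
Qed.

Lemma is_pd_mull k b F x a : is_pd k F x a -> is_pd k (fun y => b * F y) x (b * a).
Proof.
move=> dF; have := is_pd_mul (is_pd_cst k b x) dF.
by rewrite mul0r add0r.
Qed.

Lemma is_pd_sum k (I : Type) (r : seq I) (F : I -> V -> R[i]) x (a : I -> R[i]) :
  (forall i, is_pd k (F i) x (a i)) ->
  is_pd k (fun y => \sum_(i <- r) F i y) x (\sum_(i <- r) a i).
Proof.
move=> dF; elim: r => [|i r IHr].
  by under eq_fun do rewrite big_nil; rewrite big_nil; exact: is_pd_cst.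
by under eq_fun do rewrite big_cons; rewrite big_cons; exact: is_pd_add.
Qed.

Lemma is_pd_coord k (j : 'I_M) x : is_pd k (fun y => (y 0 j)%:C%C) x (k == j)%:R.
Proof.
split => /=; last first.
  by case: (k == j); exact: is_derive_cst.
have L : is_derive x (ebase R k) (fun y : V => y 0 j) ((ebase R k) 0 j).
  suff L : (fun h : R => h^-1 *: (((fun y : V => y 0 j) \o shift x) (h *: ebase R k)
      - x 0 j)) @ 0^' --> (ebase R k) 0 j.
    apply: DeriveDef; last exact: cvg_lim L.
    by apply/cvg_ex; eexists; exact: L.
  apply: cvg_near_cst; near=> h.
  rewrite /= !mxE addrK /GRing.scale /= mulKf //.
  by near: h; exact: nbhs_dnbhs_neq.
by apply: (is_derive_eq L); rewrite mxE eqxx eq_sym; case: (k == j).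
Unshelve. all: by end_near. Qed.

End ComplexPartialDerivatives.

Section Operators.
Variables (R : realType) (n : nat).
Local Notation V := 'rV[R]_(4 * n).
Implicit Types (f : V -> R[i]) (x : V) (l m : 'I_n).

Lemma imi_sqr : imi R * imi R = -1.
Proof. by apply/eqP; rewrite eq_complex /=; apply/andP; split; apply/eqP; ring. Qed.

Lemma split_lshift l : fintype.split (lshift n l) = inl l.
Proof. exact: (unsplitK (inl l)). Qed.

Lemma split_rshift l : fintype.split (rshift n l) = inr l.
Proof. exact: (unsplitK (inr l)). Qed.

(** The coefficients do not depend on [f], so the product rule for these fields needs no case
    analysis on [A]. *)
Lemma nablaA_pd (A : 'I_(n + n)) A' : exists k1 k2 (a b : R[i]),
  forall (f : V -> R[i]), nablaA A A' f = fun x => a * pd k1 f x + b * pd k2 f x.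
Proof.
rewrite /nablaA; case: (fintype.split A) => l; case: A'; do 2!eexists.
- by exists 2^-1, (- (2^-1 * imi R)) => f; apply/funext => x; rewrite mulrBr mulrA mulNr.
- by exists (- 2^-1), (2^-1 * imi R) => f; apply/funext => x; rewrite mulrDr mulrN mulrA mulNr.
- by exists 2^-1, (2^-1 * imi R) => f; apply/funext => x; rewrite mulrDr mulrA.
- by exists 2^-1, (2^-1 * imi R) => f; apply/funext => x; rewrite mulrDr mulrA.
Qed.

Lemma is_pd_zA1 k (B : 'I_(n + n)) x :
  is_pd k (zA B p1) x (match fintype.split B with
    | inl l => - (k == cidx l 2)%:R - imi R * (k == cidx l 3)%:R
    | inr l => (k == cidx l 0)%:R - imi R * (k == cidx l 1)%:R
    end).
Proof.
rewrite /zA; case: (fintype.split B) => l.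
  apply: is_pd_add; first exact/is_pd_opp/is_pd_coord.
  exact/is_pd_opp/is_pd_mull/is_pd_coord.
apply: is_pd_add; first exact: is_pd_coord.
exact/is_pd_opp/is_pd_mull/is_pd_coord.
Qed.

(* This is why [R^0' R^1'] has no first-order part. *)
Lemma nablaA0_zA1 (A B : 'I_(n + n)) x : nablaA A p0 (zA B p1) x = 0.
Proof.
rewrite /nablaA; case: (fintype.split A) => l; rewrite !(is_pd_val (is_pd_zA1 _ B x));
  case: (fintype.split B) => m; rewrite !cidx_eq; case: (l == m) => /=; ring: imi_sqr.
Qed.

Lemma nablaA0_Rop1 (A : 'I_(n + n)) f x :
  (forall B k, exists a, is_pd k (nablaA B p1 f) x a) ->
  nablaA A p0 (Rop p1 f) x = \sum_B zA B p1 x * nablaA A p0 (nablaA B p1 f) x.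
Proof.
move=> df; have [k1 [k2 [a [b nE]]]] := nablaA_pd A p0.
have pdE k : pd k (Rop p1 f) x =
    \sum_B (pd k (zA B p1) x * nablaA B p1 f x + zA B p1 x * pd k (nablaA B p1 f) x).
  apply: is_pd_val; apply: is_pd_sum => B; apply: is_pd_mul.
    by rewrite (is_pd_val (is_pd_zA1 k B x)); exact: is_pd_zA1.
  by have [c dc] := df B k; rewrite (is_pd_val dc).
rewrite nE !pdE !mulr_sumr -big_split; apply: eq_bigr => B _ /=.
have := nablaA0_zA1 A B x; rewrite !nE.
move: (pd k1 (zA B p1) x) (pd k2 (zA B p1) x) (zA B p1 x) => d1 d2 z.
move: (nablaA B p1 f x) (pd k1 _ x) (pd k2 _ x) => F e1 e2 E.
(* Regrouping exposes the factor [a d1 + b d2], the derivative of [z_B^1'], which is zero. *)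
rewrite [RHS](_ : _ = (a * d1 + b * d2) * F + z * (a * e1 + b * e2)); first by ring.
by rewrite E mul0r add0r.
Qed.

Lemma frakD_sub_Rop f x :
  (forall B k, exists a, is_pd k (nablaA B p1 f) x a) ->
  frakD f x - Rop p0 (Rop p1 f) x =
  \sum_A \sum_B (zA A p1 x * zA B p0 x - zA A p0 x * zA B p1 x)
                 * nablaA A p0 (nablaA B p1 f) x.
Proof.
move=> df; rewrite /frakD {1}/Rop -sumrB; apply: eq_bigr => A _.
rewrite nablaA0_Rop1 // mulr_sumr -sumrB; apply: eq_bigr => B _.
by rewrite mulrBl !mulrA.
Qed.

(** In each slot, [z_l^0'] and [z_(n+l)^1'] have conjugate coefficients, as do their fields, so the
    imaginary cross terms cancel; the same holds for [z_l^1'] and [z_(n+l)^0'] up to sign. *)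
Lemma Rop_add f x :
  Rop p0 f x + Rop p1 f x = \sum_i (x 0 i)%:C%C * pd i f x.
Proof.
rewrite /Rop -big_split big_split_ord /= -big_split sum_cidx.
apply: eq_bigr => l _; rewrite sum_ord4 /zA /nablaA !split_lshift !split_rshift /xC /=.
move: (pd (cidx l 0) f x) (pd (cidx l 1) f x) (pd (cidx l 2) f x) (pd (cidx l 3) f x).
move: (x 0 (cidx l 0))%:C%C (x 0 (cidx l 1))%:C%C.
move: (x 0 (cidx l 2))%:C%C (x 0 (cidx l 3))%:C%C => x2 x3 x0 x1 g0 g1 g2 g3.
by field: imi_sqr.
Qed.

End Operators.

(** * The second-order identity for one pair of quaternionic slots *)

Section PairAlgebra.
Variable R : realType.
Implicit Types (x y : 'I_4 -> R) (H : 'I_4 -> 'I_4 -> R[i]).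

(* For [H c d = d^2 f / d(q_l)_c d(q_m)_d], [x = q_l] and [y = q_m], the two sums
   below are the contributions of the pair [(l, m)] of quaternionic indices to
   [sum_(ij) (q q^* )_ij f_ij] and to [D - R^0' R^1'] respectively. They agree up
   to the factor [-1/4] only after symmetrization in [(l, m)]. *)
Definition gram_sum x y H : R[i] :=
  \sum_c \sum_d (qcoord (Quat (x 0) (x 1) (x 2) (x 3)
    * conjq (Quat (y 0) (y 1) (y 2) (y 3)) * qunit R d) c)%:C%C * H c d.

Definition wedge_sum x y H : R[i] :=
  let i := imi R in
  let zl0 u : R[i] := (u 0)%:C%C + i * (u 1)%:C%C in
  let zl1 u : R[i] := - (u 2)%:C%C - i * (u 3)%:C%C in
  let zr0 u : R[i] := (u 2)%:C%C - i * (u 3)%:C%C in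
  let zr1 u : R[i] := (u 0)%:C%C - i * (u 1)%:C%C in
  let Hl c := 2^-1 * (- H c 2 + i * H c 3) in
  let Hr c := 2^-1 * (H c 0 + i * H c 1) in
  (zl1 x * zl0 y - zl0 x * zl1 y) * (2^-1 * (Hl 0 - i * Hl 1))
  + (zl1 x * zr0 y - zl0 x * zr1 y) * (2^-1 * (Hr 0 - i * Hr 1))
  + ((zr1 x * zl0 y - zr0 x * zl1 y) * (2^-1 * (Hl 2 + i * Hl 3))
     + (zr1 x * zr0 y - zr0 x * zr1 y) * (2^-1 * (Hr 2 + i * Hr 3))).

(** A polynomial identity modulo [i^2 = -1] in the eight coordinates and sixteen entries. The
    exchanged pair carries the transpose of [H], as a symmetric Hessian dictates. *)
Lemma wedge_gram x y H :
  wedge_sum x y H + wedge_sum y x (fun c d => H d c) =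
  - 4^-1 * (gram_sum x y H + gram_sum y x (fun c d => H d c)).
Proof.
rewrite /wedge_sum /gram_sum sum_ord4 !sum_ord4 /qcoord /=.
have ii := imi_sqr R; move: (imi R) ii => i ii.
move: (x 0) (x 1) (x 2) (x 3) (y 0) (y 1) (y 2) (y 3).
move=> x0 x1 x2 x3 y0 y1 y2 y3.
move: (H 0 0) (H 0 1) (H 0 2) (H 0 3) => h00 h01 h02 h03.
move: (H 1 0) (H 1 1) (H 1 2) (H 1 3) => h10 h11 h12 h13.
move: (H 2 0) (H 2 1) (H 2 2) (H 2 3) => h20 h21 h22 h23.
move: (H 3 0) (H 3 1) (H 3 2) (H 3 3) => h30 h31 h32 h33.
by field: ii.
Qed.

End PairAlgebra.

Section SecondOrderPart.
Variables (R : realType) (n : nat) (f : 'rV[R]_(4 * n) -> R[i]) (q : 'rV[R]_(4 * n)).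
Local Notation h i j := (pd j (pd i f) q).

Hypothesis pd_pd : forall i j, is_pd j (pd i f) q (h i j).
Hypothesis h_sym : forall i j, h i j = h j i.

Let pd_nabla_l (m : 'I_n) j : is_pd j (nablaA (lshift n m) p1 f) q
  (2^-1 * (- h (cidx m 2) j + imi R * h (cidx m 3) j)).
Proof.
rewrite /nablaA split_lshift; apply: is_pd_mull; apply: is_pd_add.
  exact/is_pd_opp/pd_pd.
exact/is_pd_mull/pd_pd.
Qed.

Let pd_nabla_r (m : 'I_n) j : is_pd j (nablaA (rshift n m) p1 f) q
  (2^-1 * (h (cidx m 0) j + imi R * h (cidx m 1) j)).
Proof.
rewrite /nablaA split_rshift; apply: is_pd_mull; apply: is_pd_add.
  exact/pd_pd.
exact/is_pd_mull/pd_pd.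
Qed.

Lemma is_pd_nablaA B k : exists a, is_pd k (nablaA B p1 f) q a.
Proof.
by rewrite -(splitK B); case: (fintype.split B) => m; eexists;
  [exact: pd_nabla_l|exact: pd_nabla_r].
Qed.

Lemma pair_sumE (l m : 'I_n) :
  \sum_c \sum_d (outer q (cidx l c) (cidx m d))%:C%C * h (cidx l c) (cidx m d) =
  gram_sum (fun c => q 0 (cidx l c)) (fun d => q 0 (cidx m d))
    (fun c d => h (cidx l c) (cidx m d)).
Proof.
apply: eq_bigr => c _; apply: eq_bigr => d _; congr (_%:C%C * _).
by rewrite /outer !cidx_qidx !ccomp_cidx !mxE.
Qed.

Let T A B := (zA A p1 q * zA B p0 q - zA A p0 q * zA B p1 q)
                 * nablaA A p0 (nablaA B p1 f) q.

Lemma pair_nablaE (l m : 'I_n) :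
  T (lshift n l) (lshift n m) + T (lshift n l) (rshift n m)
  + (T (rshift n l) (lshift n m) + T (rshift n l) (rshift n m)) =
  wedge_sum (fun c => q 0 (cidx l c)) (fun d => q 0 (cidx m d))
    (fun c d => h (cidx l c) (cidx m d)).
Proof.
rewrite /T /zA ![nablaA _ p0 _ _]/nablaA !split_lshift !split_rshift.
rewrite !(is_pd_val (pd_nabla_l _ _)) !(is_pd_val (pd_nabla_r _ _)) /xC.
(* The field with index [B] acts first, so the slot [m] comes first in [h], whereas [wedge_sum]
   expects [l] first. *)
by rewrite ![h (cidx m _) (cidx l _)]h_sym.
Qed.

(** Both sides are cut into blocks [(l, m)] and doubled, which pairs each block with [(m, l)] so
    that [wedge_gram] applies. *)
Lemma second_order_part :
  frakD f q - Rop p0 (Rop p1 f) q =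
  - 4^-1 * \sum_i \sum_j (outer q i j)%:C%C * h i j.
Proof.
rewrite frakD_sub_Rop; last exact: is_pd_nablaA.
set LHS := LHS; set S := \sum_i _.
pose Tp l m := wedge_sum (fun c => q 0 (cidx l c)) (fun d => q 0 (cidx m d))
    (fun c d => h (cidx l c) (cidx m d)).
pose Sp l m := gram_sum (fun c => q 0 (cidx l c)) (fun d => q 0 (cidx m d))
    (fun c d => h (cidx l c) (cidx m d)).
have LE : LHS = \sum_l \sum_m Tp l m.
  rewrite /LHS big_split_ord /= -big_split; apply: eq_bigr => l _ /=.
  rewrite !big_split_ord /= -!big_split /=; apply: eq_bigr => m _.
  exact: pair_nablaE.
have SE : S = \sum_l \sum_m Sp l m.
  rewrite /S sum_cidx; apply: eq_bigr => l _.
  under eq_bigr => c _ do rewrite sum_cidx.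
  rewrite exchange_big; apply: eq_bigr => m _; exact: pair_sumE.
have flip (F : 'I_n -> 'I_n -> R[i]) :
    2 * \sum_l \sum_m F l m = \sum_l \sum_m (F l m + F m l).
  rewrite mulr_natl mulr2n {2}exchange_big -big_split; apply: eq_bigr => l _ /=.
  by rewrite -big_split.
apply: (@mulfI _ (2 : R[i])); first by rewrite pnatr_eq0.
rewrite LE SE mulrCA !flip mulr_sumr; apply: eq_bigr => l _.
rewrite mulr_sumr; apply: eq_bigr => m _.
(* The Hessian block of [(m, l)] is the transpose of that of [(l, m)]. *)
have hT : (fun c d => h (cidx m c) (cidx l d)) = (fun c d => h (cidx l d) (cidx m c)).
  by apply/funext => c; apply/funext => d; exact: h_sym.
pose x c := q 0 (cidx l c); pose y d := q 0 (cidx m d).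
pose K c d := h (cidx l c) (cidx m d).
exact: (etrans (congr1 (fun F => wedge_sum x y K + wedge_sum y x F) hT)
  (etrans (wedge_gram x y K)
    (congr1 (fun F => - 4^-1 * (gram_sum x y K + gram_sum y x F)) (esym hT)))).
Qed.

End SecondOrderPart.

Lemma Ck2_partials (R : realType) (N : nat) (U : set 'rV[R]_N) u x :
  Ck 2 U u -> U x -> forall i j,
  [/\ derivable u x (ebase R i),
      derivable (fun z => 'D_(ebase R i) u z) x (ebase R j) &
      {for x, continuous (fun y => 'D_(ebase R j) (fun z => 'D_(ebase R i) u z) y)}].
Proof.
move=> [_ D1] Ux i j; have [du [_ D2]] := D1 i; have [ddu [cdu _]] := D2 j.
by split; [exact: du|exact: ddu|exact: cdu].
Qed.

Lemma Ck2_symmetric (R : realType) (N : nat) (U : set 'rV[R]_N) u x :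
  open U -> Ck 2 U u -> U x -> forall i j,
  'D_(ebase R j) (fun z => 'D_(ebase R i) u z) x =
  'D_(ebase R i) (fun z => 'D_(ebase R j) u z) x.
Proof.
move=> oU uC2 Ux i j; apply: derive_symmetric => [k|k l|k l].
- by apply: (nearU oU Ux) => y /(Ck2_partials uC2) /(_ k k) [].
- by apply: (nearU oU Ux) => y /(Ck2_partials uC2) /(_ k l) [].
- by have [] := Ck2_partials uC2 Ux k l.
Qed.

(** * Complex-valued functions and the final formula *)

Section LaplaceQM.
Variables (R : realType) (n : nat) (f : 'rV[R]_(4 * n) -> R[i]) (q : 'rV[R]_(4 * n)).
Hypotheses (f_C2 : CkC 2 (@unitball R n) f) (q_in : unitball q).

Lemma CkC_is_pd i j : is_pd j (pd i f) q (pd j (pd i f) q).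
Proof.
have [reC2 imC2] := f_C2; split.
  by have [_ dd _] := Ck2_partials reC2 q_in i j; exact/derivableP.
by have [_ dd _] := Ck2_partials imC2 q_in i j; exact/derivableP.
Qed.

Lemma CkC_pd_symmetric i j : pd j (pd i f) q = pd i (pd j f) q.
Proof.
have [reC2 imC2] := f_C2; have oB := @open_unitball R n.
exact: (congr2 (@Complex R) (Ck2_symmetric oB reC2 q_in i j)
  (Ck2_symmetric oB imC2 q_in i j)).
Qed.

(** All coefficients are real, so the real identity [laplace_phiR] applies separately to the real
    and imaginary parts of [f]. *)
Lemma laplaceQM_pd :
  laplaceQM f q =
  (1 - sqnormH (toH q))%:C%C *
  (laplace0 f q - \sum_i \sum_j (outer q i j)%:C%C * pd j (pd i f) q
   + 4 * \sum_i (q 0 i)%:C%C * pd i f q).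
Proof.
have [reC2 imC2] := f_C2.
have ReZ (r : R) (z : R[i]) : complex.Re (r%:C%C * z) = r * complex.Re z.
  by case: z => a b /=; ring.
have ImZ (r : R) (z : R[i]) : complex.Im (r%:C%C * z) = r * complex.Im z.
  by case: z => a b /=; ring.
have ReD (z w : R[i]) : complex.Re (z + w) = complex.Re z + complex.Re w.
  by case: z w => ? ? [].
have ImD (z w : R[i]) : complex.Im (z + w) = complex.Im z + complex.Im w.
  by case: z w => ? ? [].
have ReN (z : R[i]) : complex.Re (- z) = - complex.Re z by case: z.
have ImN (z : R[i]) : complex.Im (- z) = - complex.Im z by case: z.
have ReS (F : 'I_(4 * n) -> R[i]) :
    complex.Re (\sum_i F i) = \sum_i complex.Re (F i).
  by apply: (big_morph _ ReD).
have ImS (F : 'I_(4 * n) -> R[i]) :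
    complex.Im (\sum_i F i) = \sum_i complex.Im (F i).
  by apply: (big_morph _ ImD).
have E4 : 4 = (4 : R)%:C%C :> R[i] by rewrite rmorph_nat.
apply/eqP; rewrite eq_complex; apply/andP; split; apply/eqP.
  rewrite E4 ReZ !ReD ReN ReZ /laplaceQM /laplace0 !ReS.
  apply: (etrans (laplace_phiR q_in reC2)); congr (_ * (_ - _ + _ * _)).
    by apply: eq_bigr => i _; rewrite ReS; apply: eq_bigr => j _; rewrite ReZ.
  by apply: eq_bigr => i _; rewrite ReZ.
rewrite E4 ImZ !ImD ImN ImZ /laplaceQM /laplace0 !ImS.
apply: (etrans (laplace_phiR q_in imC2)); congr (_ * (_ - _ + _ * _)).
  by apply: eq_bigr => i _; rewrite ImS; apply: eq_bigr => j _; rewrite ImZ.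
by apply: eq_bigr => i _; rewrite ImZ.
Qed.

End LaplaceQM.

Theorem proposition1p1 (R : realType) (n : nat) (n_ge1 : (1 <= n)%N)
    (f : 'rV[R]_(4 * n) -> R[i]) (f_C2 : CkC 2 (@unitball R n) f) :
  forall q : 'rV[R]_(4 * n), unitball q ->
    laplaceQM f q =
      4 * (1 - (sqnormH (toH q))%:C)%C *
      (4^-1 * laplace0 f q + frakD f q - Rop p0 (Rop p1 f) q
       + Rop p0 f q + Rop p1 f q).
Proof.
move=> q q_in; rewrite laplaceQM_pd //.
have := second_order_part (CkC_is_pd f_C2 q_in) (CkC_pd_symmetric f_C2 q_in).
have -> : (1 - (sqnormH (toH q))%:C)%C = (1 - sqnormH (toH q))%:C%C :> R[i].
  by rewrite rmorphB rmorph1.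
(* Regrouping isolates the Euler field [R^0' + R^1'] and the difference [D - R^0' R^1']; the factor
   [4] then clears the two quarters. *)
rewrite -[_ - Rop p0 _ q + _ + _]addrA Rop_add -[_ + frakD f q - _]addrA => ->.
move: (\sum_i _) (\sum_i _) (laplace0 f q) (_%:C%C) => S G L r; by field.
Qed.
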